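(* There is a strictly decreasing mapping $\{\lambda_{k/2}\}_{k\ge2}$ with $\lambda_1=\|b_3\|$ and $\lambda_{k/2}\to0$ as $k\to\infty$, such that for all $k\ge2$ and all $v,v_1,v_2\in\mathbb R^d$ with $\bm u=\binom{v_1-v}{v_2-v}\ne0$, $$\int_{\mathbb S^{2d-1}}b_3(\bar{\bm u}\cdot\bm\omega,\omega_1\cdot\omega_2)\big(\langle v^*\rangle^k+\langle v_1^*\rangle^k+\langle v_2^*\rangle^k\big)\,d\bm\omega\le\lambda_{k/2}\,E_3^{k/2},$$ where $E_3:=\langle v\rangle^2+\langle v_1\rangle^2+\langle v_2\rangle^2$ denotes the ternary kinetic energy. The mapping $\{\lambda_{k/2}\}_{k\ge2}$ is called the ternary coercive map.
   Context: Let $d$ be the dimension of velocity space and $\langle v\rangle=\sqrt{1+|v|^2}$ for $v\in\mathbb R^d$. For $v,v_1,v_2\in\mathbb R^d$ and $\bm\omega=(\omega_1,\omega_2)\in\mathbb S^{2d-1}\subset\mathbb R^{2d}$ put $\bm u=(v_1-v,v_2-v)$, $|\tilde{\bm u}|=(|v-v_1|^2+|v-v_2|^2+|v_1-v_2|^2)^{1/2}$, $\hat{\bm u}=\bm u/|\bm u|$, $\bar{\bm u}=\bm u/|\tilde{\bm u}|$, and $$v^*=v+c(\omega_1+\omega_2),\quad v_1^*=v_1-c\,\omega_1,\quad v_2^*=v_2-c\,\omega_2,\qquad c=\frac{\bm u\cdot\bm\omega}{1+\omega_1\cdot\omega_2}.$$ The angular kernel $b_3:[-1,1]\times[-\tfrac12,\tfrac12]\to[0,\infty)$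 is of the form $b_3(x,y)=|x|^{\theta_3}\phi(y)$ with $\theta_3\ge0$ and $\phi\in L^\infty([-\tfrac12,\tfrac12])$, and it satisfies the cut-off condition $$\|b_3\|:=\int_{\mathbb S^{2d-1}}b_3(\hat{\bm u}\cdot\bm\omega,\omega_1\cdot\omega_2)\,d\bm\omega<\infty;$$ it is asserted, by spherical symmetry, that this quantity is independent of the direction $\hat{\bm u}$.
   Formalization: The formal statement assumes ‖b₃‖>0 (for b₃=0 a.e. no strictly decreasing map with λ₁=0 and limit 0 exists) and takes as a hypothesis the asserted independence of ‖b₃‖ from the direction û, which can fail (e.g. θ₃=2, φ not even), leaving ‖b₃‖ undefined. *)

(* Defs.v *)
From HB Require Import structures.
From mathcomp Require Import all_boot all_order all_algebra.
From mathcomp Require Import all_classical all_reals all_analysis.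
From mathcomp Require Import measurable_realfun.

Set Implicit Arguments.
Unset Strict Implicit.
Unset Printing Implicit Defensive.

Import Order.TTheory GRing.Theory Num.Theory.
Import numFieldNormedType.Exports.

Local Open Scope classical_set_scope.
Local Open Scope ring_scope.

(* R^n is 'rV[R]_n.  The library's `|x| on 'rV[R]_n is the sup norm, so the
   Euclidean structure is introduced here. *)
Section euclidean.
Context {R : realType} {n : nat}.
Implicit Types x y : 'rV[R]_n.

Definition dotv x y : R := \sum_(i < n) x ord0 i * y ord0 i.
Definition enorm x : R := Num.sqrt (dotv x x).
Definition usphere : set 'rV[R]_n := [set x | enorm x = 1].
Definition japanese x : R := Num.sqrt (1 + enorm x ^+ 2).

End euclidean.
Arguments usphere : clear implicits.

(* The Borel sigma-algebra of R^n, generated by the coordinates; this is the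
   construction that the library uses for n.-tuple. *)
Section rv_measurable.
Context {R : realType} {n : nat}.

Definition rv_coord (i : 'I_n) (x : 'rV[R]_n) : R := x ord0 i.

Let rv_set0 : g_sigma_preimage rv_coord set0.
Proof. exact: sigma_algebra0. Qed.

Let rv_setC A : g_sigma_preimage rv_coord A -> g_sigma_preimage rv_coord (~` A).
Proof. exact: sigma_algebraC. Qed.

Let rv_bigcup (F : (set 'rV[R]_n)^nat) :
  (forall i, g_sigma_preimage rv_coord (F i)) ->
  g_sigma_preimage rv_coord (\bigcup_i (F i)).
Proof. exact: sigma_algebra_bigcup. Qed.

HB.instance Definition _ := @isMeasurable.Build default_measure_display
  'rV[R]_n (g_sigma_preimage rv_coord) rv_set0 rv_setC rv_bigcup.

Lemma measurable_rv_coord (i : 'I_n) : measurable_fun setT (rv_coord i).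
Proof.
move=> _ Y mY; rewrite setTI; apply: sub_sigma_algebra => /=.
rewrite -bigcup_seq/=; exists i => /=; first by rewrite mem_index_enum.
by exists Y => //; rewrite setTI.
Qed.

Lemma measurable_fun_rvP d (T : measurableType d) (f : T -> 'rV[R]_n) :
  (forall i, measurable_fun setT (rv_coord i \o f)) -> measurable_fun setT f.
Proof.
move=> mf.
have H : g_sigma_preimage (fun i => rv_coord i \o f) `<=` measurable.
  apply: smallest_sub; first exact: sigma_algebra_measurable.
  rewrite -bigcup_seq; apply: bigcup_sub => i _ A [B mB <-].
  exact: mf.
move=> _ A mA; apply: H.
by rewrite g_sigma_preimage_comp; exists A.
Qed.

End rv_measurable.

Definition rv_cons {R : realType} {n : nat} (x : R) (w : 'rV[R]_n) :
  'rV[R]_n.+1 := row_mx (x%:M : 'rV[R]_1) w.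

Section rv_cons.
Context {R : realType} {n : nat}.
Implicit Types (x : R) (w : 'rV[R]_n).

Lemma rv_cons0 x w : rv_cons x w ord0 ord0 = x.
Proof.
rewrite /rv_cons (_ : ord0 = lshift n (ord0 : 'I_1)); last exact/val_inj.
by rewrite (row_mxEl (x%:M : 'rV[R]_1)) mxE eqxx mulr1n.
Qed.

Lemma rv_consS x w i : rv_cons x w ord0 (lift ord0 i) = w ord0 i.
Proof.
rewrite /rv_cons (_ : lift ord0 i = rshift 1 i); last exact/val_inj.
by rewrite (row_mxEr (x%:M : 'rV[R]_1)).
Qed.

Definition rv_uncons (v : 'rV[R]_n.+1) : R * 'rV[R]_n :=
  (v ord0 ord0, \row_j v ord0 (lift ord0 j)).

Lemma rv_unconsK v : rv_cons (rv_uncons v).1 (rv_uncons v).2 = v.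
Proof.
apply/rowP => i; case: (unliftP ord0 i) => [j ->|->].
  by rewrite rv_consS mxE.
by rewrite rv_cons0.
Qed.

Lemma rv_consK x w : rv_uncons (rv_cons x w) = (x, w).
Proof.
by congr pair; [exact: rv_cons0|apply/rowP => j; rewrite mxE rv_consS].
Qed.

Lemma measurable_rv_cons :
  measurable_fun setT (fun p : R * 'rV[R]_n => rv_cons p.1 p.2).
Proof.
apply: measurable_fun_rvP => i; case: (unliftP ord0 i) => [j ->|->].
  rewrite [X in measurable_fun _ X](_ : _ = rv_coord j \o snd).
    by apply: measurableT_comp => //; exact: measurable_rv_coord.
  by apply/funext => p /=; rewrite /rv_coord rv_consS.
rewrite [X in measurable_fun _ X](_ : _ = fst) //.
by apply/funext => p /=; rewrite /rv_coord rv_cons0.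
Qed.

Lemma measurable_rv_uncons : measurable_fun setT rv_uncons.
Proof.
apply: measurable_fun_pair; first exact: measurable_rv_coord.
apply: measurable_fun_rvP => i.
rewrite [X in measurable_fun _ X](_ : _ = rv_coord (lift ord0 i)).
  exact: measurable_rv_coord.
by apply/funext => p /=; rewrite /rv_coord mxE.
Qed.

End rv_cons.

(* n-dimensional Lebesgue measure, by Cavalieri's principle. *)
Definition cavalieri {R : realType} {n : nat} (m : set 'rV[R]_n -> \bar R)
    (A : set 'rV[R]_n.+1) : \bar R :=
  (\int[lebesgue_measure]_x m [set w | A (rv_cons x w)])%E.

Fixpoint lebesgue_rv {R : realType} (n : nat) : set 'rV[R]_n -> \bar R :=
  match n with
  | 0 => \d_(0 : 'rV[R]_0)
  | n'.+1 => cavalieri (@lebesgue_rv R n')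
  end.

Section cavalieri_measure.
Local Open Scope ereal_scope.
Context {R : realType} {n : nat}.
Variable m : {sigma_finite_measure set 'rV[R]_n -> \bar R}.

Lemma cavalieriE (A : set 'rV[R]_n.+1) :
  cavalieri m A =
  (lebesgue_measure \x m) ((fun p => rv_cons p.1 p.2) @^-1` A).
Proof.
apply: eq_integral => x _ /=; congr (m _).
by apply/seteqP; split => w; rewrite /xsection/= ?inE.
Qed.

Let mpre (A : set 'rV[R]_n.+1) : measurable A ->
  measurable ((fun p : R * 'rV[R]_n => rv_cons p.1 p.2) @^-1` A).
Proof. by move=> mA; rewrite -[X in measurable X]setTI; exact: measurable_rv_cons. Qed.

Let cavalieri0 : cavalieri m set0 = 0.
Proof. by rewrite cavalieriE preimage_set0 measure0. Qed.

Let cavalieri_ge0 A : 0 <= cavalieri m A.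
Proof. by rewrite cavalieriE; apply: measure_ge0. Qed.

Let cavalieri_sigma_additive : semi_sigma_additive (cavalieri m).
Proof.
move=> F mF tF mUF; rewrite cavalieriE preimage_bigcup.
rewrite (_ : (fun _ => _) = (fun k => \sum_(0 <= i < k)
    (lebesgue_measure \x m) ((fun p => rv_cons p.1 p.2) @^-1` F i))); last first.
  by apply/funext => k; apply: eq_bigr => i _; rewrite cavalieriE.
apply: measure_semi_sigma_additive.
- by move=> k; exact: mpre.
- apply/trivIsetP => /= i j _ _ ij; rewrite -preimage_setI.
  by move/trivIsetP : tF => /(_ _ _ _ _ ij) ->//; rewrite preimage_set0.
- by rewrite -preimage_bigcup; exact: mpre.
Qed.

HB.instance Definition _ := isMeasure.Build _ _ _ (cavalieri m)
  cavalieri0 cavalieri_ge0 cavalieri_sigma_additive.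

Let cavalieri_sigma_finite : sigma_finite setT (cavalieri m).
Proof.
have /sigma_finiteP[F [TF ndF Foo]] := sigma_finiteT (@lebesgue_measure R).
have /sigma_finiteP[G [TG ndG Goo]] := sigma_finiteT m.
exists (fun k => rv_uncons @^-1` (F k `*` G k)).
  apply/esym; rewrite -subTset => v _; have : setT (rv_uncons v).1 by [].
  rewrite TF => -[i _ Fi]; have : setT (rv_uncons v).2 by [].
  rewrite TG => -[j _ Gj]; exists (maxn i j) => //; split.
    by apply: (subsetPset _ _ (ndF _ _ (leq_maxl i j))).
  by apply: (subsetPset _ _ (ndG _ _ (leq_maxr i j))).
move=> k; have [mF Fk] := Foo k; have [mG Gk] := Goo k; split.
  rewrite -[X in measurable X]setTI; apply: measurable_rv_uncons => //.
  exact: measurableX.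
rewrite cavalieriE (_ : _ @^-1` _ = F k `*` G k).
  by rewrite product_measure1E// lte_mul_pinfty// ge0_fin_numE.
by apply/funext => -[x w]; rewrite /preimage /mkset rv_consK.
Qed.

HB.instance Definition _ := Measure_isSigmaFinite.Build _ _ _ (cavalieri m)
  cavalieri_sigma_finite.

End cavalieri_measure.

Section lebesgue_rv_measure.
Local Open Scope ereal_scope.
Context {R : realType}.

Lemma lebesgue_rv_sigma_finite_measure n :
  exists m : {sigma_finite_measure set 'rV[R]_n -> \bar R},
    @lebesgue_rv R n = m.
Proof.
elim: n => [|n [m mE]].
  by exists (\d_(0 : 'rV[R]_0)%R : {finite_measure set _ -> \bar R}).
by exists (cavalieri m); rewrite /= mE.
Qed.

Variable n : nat.

Let lebesgue_rv0 : @lebesgue_rv R n set0 = 0.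
Proof.
by have [m ->] := lebesgue_rv_sigma_finite_measure n; rewrite measure0.
Qed.

Let lebesgue_rv_ge0 A : 0 <= @lebesgue_rv R n A.
Proof.
by have [m ->] := lebesgue_rv_sigma_finite_measure n; exact: measure_ge0.
Qed.

Let lebesgue_rv_sigma_additive : semi_sigma_additive (@lebesgue_rv R n).
Proof.
have [m ->] := lebesgue_rv_sigma_finite_measure n.
exact: measure_semi_sigma_additive.
Qed.

HB.instance Definition _ := isMeasure.Build _ _ _ (@lebesgue_rv R n)
  lebesgue_rv0 lebesgue_rv_ge0 lebesgue_rv_sigma_additive.

Let lebesgue_rv_sigma_finite : sigma_finite setT (@lebesgue_rv R n).
Proof.
by have [m ->] := lebesgue_rv_sigma_finite_measure n; exact: sigma_finiteT.
Qed.

HB.instance Definition _ := Measure_isSigmaFinite.Build _ _ _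
  (@lebesgue_rv R n) lebesgue_rv_sigma_finite.

End lebesgue_rv_measure.

Section euclidean_measurable.
Context {R : realType} {n : nat}.

Lemma measurable_enorm : measurable_fun setT (@enorm R n).
Proof.
rewrite (_ : enorm = (fun t => t `^ 2^-1) \o (fun x => dotv x x)); last first.
  apply/funext => x /=; rewrite powR12_sqrt//.
  by apply: sumr_ge0 => i _; rewrite -expr2 sqr_ge0.
apply: measurableT_comp; first exact: measurable_powR.
apply: measurable_sum => i.
by apply: measurable_funM; exact: (@measurable_rv_coord R n i).
Qed.

Lemma measurable_normalize :
  measurable_fun setT (fun x : 'rV[R]_n => (enorm x)^-1 *: x).
Proof.
apply: measurable_fun_rvP => i.
rewrite (_ : _ \o _ = (fun x => enorm x `^ (- 1)) \* rv_coord i); last first.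
  by apply/funext => x /=; rewrite powR_inv1 ?sqrtr_ge0// /rv_coord mxE.
apply: measurable_funM; last exact: measurable_rv_coord.
apply: (measurableT_comp (measurable_powR _)); exact: measurable_enorm.
Qed.

End euclidean_measurable.

(* The surface measure of the unit sphere of R^n, as a measure on R^n carried
   by usphere R n: n times the Lebesgue measure of the truncated cone over A.
   This is the normalization of integration in polar coordinates. *)
Definition sphere_measure {R : realType} (n : nat) (A : set 'rV[R]_n) : \bar R :=
  (n%:R%:E * lebesgue_rv
     [set x | (0 < enorm x <= 1)%R /\ A ((enorm x)^-1 *: x)%R])%E.

Section sphere_measure_measure.
Local Open Scope ereal_scope.
Context {R : realType} {n : nat}.

Let cone (A : set 'rV[R]_n) : set 'rV[R]_n :=
  [set x | (0 < enorm x <= 1)%R /\ A ((enorm x)^-1 *: x)%R].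

Let coneE A :
  cone A = enorm @^-1` `]0%R, 1%R] `&` (fun x => (enorm x)^-1 *: x)%R @^-1` A.
Proof. by apply/seteqP; split => x /=; rewrite in_itv. Qed.

Let measurable_cone A : measurable A -> measurable (cone A).
Proof.
move=> mA; rewrite coneE; apply: measurableI.
  by rewrite -[X in measurable X]setTI; exact: measurable_enorm.
by rewrite -[X in measurable X]setTI; exact: measurable_normalize.
Qed.

Let sphere_measure0 : @sphere_measure R n set0 = 0.
Proof.
rewrite /sphere_measure (_ : [set x | _] = set0) ?measure0 ?mule0//.
by apply/seteqP; split => x //= -[].
Qed.

Let sphere_measure_ge0 A : 0 <= @sphere_measure R n A.
Proof. by rewrite /sphere_measure mule_ge0// lee_fin. Qed.

Let sphere_measure_sigma_additive : semi_sigma_additive (@sphere_measure R n).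
Proof.
move=> F mF tF mUF.
rewrite [X in X @ \oo --> _](_ : _ =
    (fun k => n%:R%:E * \sum_(0 <= i < k) lebesgue_rv (cone (F i)))); last first.
  by apply/funext => k; rewrite ge0_sume_distrr.
rewrite /sphere_measure -/(cone _); apply: cvgeZl => //.
have -> : cone (\bigcup_k F k) = \bigcup_k cone (F k).
  by apply/seteqP; split => [x [h [k _ Fk]]|x [k _ [h Fk]]];
    [exists k|split => //; exists k].
apply: measure_semi_sigma_additive.
- by move=> k; exact: measurable_cone.
- apply/trivIsetP => /= i j _ _ ij; rewrite !coneE setIACA
    -[X in _ `&` X = _]preimage_setI.
  by move/trivIsetP : tF => /(_ _ _ _ _ ij) ->//; rewrite preimage_set0 setI0.
- by apply: bigcupT_measurable => k; exact: measurable_cone.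
Qed.

HB.instance Definition _ := isMeasure.Build _ _ _ (@sphere_measure R n)
  sphere_measure0 sphere_measure_ge0 sphere_measure_sigma_additive.

End sphere_measure_measure.

Section ternary_collision.
Context {R : realType} {d : nat}.
Implicit Types (v : 'rV[R]_d) (omega : 'rV[R]_(d + d)).

Definition rel_velocity v v1 v2 : 'rV[R]_(d + d) := row_mx (v1 - v) (v2 - v).

Definition tilde_norm v v1 v2 : R :=
  Num.sqrt (enorm (v - v1) ^+ 2 + enorm (v - v2) ^+ 2 + enorm (v1 - v2) ^+ 2).

Definition ubar v v1 v2 : 'rV[R]_(d + d) :=
  (tilde_norm v v1 v2)^-1 *: rel_velocity v v1 v2.

Definition coll_coef omega v v1 v2 : R :=
  dotv (rel_velocity v v1 v2) omega / (1 + dotv (lsubmx omega) (rsubmx omega)).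

Definition vstar omega v v1 v2 : 'rV[R]_d :=
  v + coll_coef omega v v1 v2 *: (lsubmx omega + rsubmx omega).
Definition v1star omega v v1 v2 : 'rV[R]_d :=
  v1 - coll_coef omega v v1 v2 *: lsubmx omega.
Definition v2star omega v v1 v2 : 'rV[R]_d :=
  v2 - coll_coef omega v v1 v2 *: rsubmx omega.

Definition ternary_energy v v1 v2 : R :=
  japanese v ^+ 2 + japanese v1 ^+ 2 + japanese v2 ^+ 2.

(* The quantity ||b_3||, as a function of the direction e = \hat u. *)
Definition b3_norm (b3 : R -> R -> R) (e : 'rV[R]_(d + d)) : \bar R :=
  (\int[@sphere_measure R (d + d)]_(omega in usphere R (d + d))
     (b3 (dotv e omega) (dotv (lsubmx omega) (rsubmx omega)))%:E)%E.

Definition ternary_gain (b3 : R -> R -> R) (k : R) v v1 v2 : \bar R :=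
  (\int[@sphere_measure R (d + d)]_(omega in usphere R (d + d))
     (b3 (dotv (ubar v v1 v2) omega) (dotv (lsubmx omega) (rsubmx omega)) *
      (japanese (vstar omega v v1 v2) `^ k +
       japanese (v1star omega v v1 v2) `^ k +
       japanese (v2star omega v v1 v2) `^ k))%:E)%E.

End ternary_collision.

(* Main.v *)
(* The collision conserves the total energy E, and each <v_i^*>^2 is at least 1,
   so the three powers sum to at most E^p, p = k / 2, and to at most
   ((1 - del) E)^(p - 1) E unless one outgoing particle carries more than
   (1 - del) E.  In that case the other two outgoing velocities are small, and
   momentum conservation forces omega to be nearly parallel to a fixed vector
   or, when that vector is short, nearly orthogonal to u: either way omega lies
   in a thin slab around a hyperplane, so the exceptional directions have small
   surface measure, uniformly in the incoming velocities.  Absolute continuity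
   of the integral of phi(omega_1 . omega_2) turns this into
   gain <= (rho ||b_3|| + (1 - rho) eps) E^p with rho = (1 - del)^(p - 1). *)
Require Import Defs.
From mathcomp Require Import all_boot all_order all_algebra.
From mathcomp Require Import all_classical all_reals all_analysis.
From mathcomp Require Import measurable_realfun ring lra.
Import Order.TTheory GRing.Theory Num.Theory.
Import numFieldNormedType.Exports.
Set Implicit Arguments.
Unset Strict Implicit.
Unset Printing Implicit Defensive.
Local Open Scope classical_set_scope.
Local Open Scope ring_scope.

(** * Lebesgue measure of slabs inside the cube *)

Section slab_volume.
Context {R : realType}.

Lemma measurable_dotv n (a : 'rV[R]_n) : measurable_fun setT (dotv a).
Proof.
apply: measurable_sum => i; apply: measurable_funM => //.
exact: measurable_rv_coord.
Qed.

Definition cube n : set 'rV[R]_n := [set x | forall j, `|x ord0 j| <= 1].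

Lemma measurable_cube n : measurable (@cube n).
Proof.
rewrite (_ : @cube n =
    \big[setI/setT]_(j < n) (rv_coord j @^-1` `[-1, 1])); last first.
  rewrite -bigcap_seq; apply/seteqP; split => x /= hx j.
    by move=> _; rewrite /= in_itv/= -ler_norml; exact: hx.
  by have := hx j (mem_index_enum j); rewrite /= in_itv/= -ler_norml.
apply: bigsetI_measurable => j _.
by rewrite -[X in measurable X]setTI; exact: measurable_rv_coord.
Qed.

Definition slab n (a : 'rV[R]_n) (t kap : R) : set 'rV[R]_n :=
  [set x | `|dotv a x + t| <= kap].

Lemma measurable_slab n (a : 'rV[R]_n) t kap : measurable (slab a t kap).
Proof.
rewrite (_ : slab _ _ _ = (fun x => dotv a x + t) @^-1` `[- kap, kap]).
  rewrite -[X in measurable X]setTI.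
  by apply: measurable_funD => //; exact: measurable_dotv.
by apply/seteqP; split => x /=; rewrite in_itv/= -ler_norml.
Qed.

Lemma dotv_rv_cons n (a : 'rV[R]_n.+1) x (w : 'rV[R]_n) :
  dotv a (rv_cons x w) = a ord0 ord0 * x + dotv (rv_uncons a).2 w.
Proof.
rewrite /dotv big_ord_recl rv_cons0; congr (_ + _).
by apply: eq_bigr => i _; rewrite rv_consS mxE.
Qed.

Lemma cube_rv_cons n x (w : 'rV[R]_n) :
  cube (rv_cons x w) <-> `|x| <= 1 /\ cube w.
Proof.
split=> [h|[h1 h2] j].
  split=> [|j]; first by rewrite -(rv_cons0 x w).
  by rewrite -(rv_consS x w).
by case: (unliftP ord0 j) => [k ->|->]; rewrite ?rv_consS ?rv_cons0//.
Qed.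

Lemma measurable_rv_cons1 n x :
  measurable_fun setT (rv_cons x : 'rV[R]_n -> 'rV[R]_n.+1).
Proof.
apply: measurable_fun_rvP => i; case: (unliftP ord0 i) => [j ->|->].
  rewrite (_ : _ \o _ = rv_coord j); first exact: measurable_rv_coord.
  by apply/funext => w /=; rewrite /rv_coord rv_consS.
rewrite (_ : _ \o _ = cst x)//.
by apply/funext => w /=; rewrite /rv_coord rv_cons0.
Qed.

Local Open Scope ereal_scope.

Lemma lebesgue_measure_itvN1 : lebesgue_measure (`[(-1)%R, 1%R]%classic : set R) = 2%:E.
Proof.
rewrite lebesgue_measure_itv/= lte_fin; case: ltP => [_|]; last by move=> h; exfalso; lra.
by rewrite -EFinB; congr EFin; lra.
Qed.

Lemma lebesgue_rv_cube n : lebesgue_rv (@cube n) <= (2 ^+ n)%:E.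
Proof.
elim: n => [|n IH]; first by rewrite /= diracE mem_set// => -[].
rewrite /= /cavalieri.
rewrite (_ : \int[_]_x _ =
    \int[lebesgue_measure]_(x in `[(-1)%R, 1%R]) lebesgue_rv (@cube n)).
  rewrite integral_cst//= lebesgue_measure_itvN1 exprSr EFinM.
  by rewrite lee_wpmul2r.
rewrite [RHS]integral_mkcond; apply: eq_integral => x _.
rewrite patchE; case: ifPn => [|] hx.
  congr (lebesgue_rv _); apply/seteqP; split=> w /= h.
    by have [] := (cube_rv_cons x w).1 h.
  apply/cube_rv_cons; split=> //; move: hx; rewrite inE/= in_itv/=.
  by rewrite -ler_norml.
rewrite (_ : [set w | _] = set0) ?measure0//.
apply/seteqP; split=> w //= /cube_rv_cons[h _].
by move/negP : hx; apply; rewrite inE/= in_itv/= -ler_norml.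
Qed.

Lemma lebesgue_measure_slab (a t kap : R) : a != 0%R -> (0 <= kap)%R ->
  lebesgue_measure [set x | `|a * x + t| <= kap]%R = (2 * (kap / `|a|))%:E.
Proof.
move=> a0 k0; have na : (0 < `|a|)%R by rewrite normr_gt0.
rewrite (_ : [set x | _] =
    `[(- (t / a) - kap / `|a|)%R, (- (t / a) + kap / `|a|)%R]%classic).
  rewrite lebesgue_measure_itv/= lte_fin; case: ltP => h.
    by rewrite -EFinB; congr EFin; lra.
  have : (0 <= kap / `|a|)%R by rewrite divr_ge0.
  by move=> h2; congr EFin; lra.
have E x : (`|a * x + t| = `|x - - (t / a)| * `|a|)%R.
  by rewrite -normrM opprK mulrDl divfK// [(x * a)%R]mulrC.
by apply/seteqP; split => x /=; rewrite in_itv/= -ler_distl ler_pdivlMr// -E.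
Qed.

(** Slicing along coordinate [i] leaves intervals of length [2 * kap / |a_i|], and the other
    coordinates contribute at most the volume of a cube. The induction peels off the first
    coordinate; the offset [t] is general because a fixed first coordinate is absorbed into it. *)
Lemma lebesgue_rv_slab n (a : 'rV[R]_n) (t kap : R) (i : 'I_n) :
  a ord0 i != 0%R -> (0 <= kap)%R ->
  lebesgue_rv (@cube n `&` slab a t kap) <= (2 ^+ n * (kap / `|a ord0 i|))%:E.
Proof.
move=> + k0; elim: n a t i => [a t []//|n IH a t i].
have mcs : measurable (@cube n.+1 `&` slab a t kap).
  by apply: measurableI; [exact: measurable_cube|exact: measurable_slab].
case: (unliftP ord0 i) => [j ->|->] ai0.
  rewrite /= /cavalieri.
  apply: (@le_trans _ _ (\int[lebesgue_measure]_(x in `[(-1)%R, 1%R])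
     (2 ^+ n * (kap / `|a ord0 (lift ord0 j)|))%:E)); last first.
    by rewrite integral_cst//= lebesgue_measure_itvN1 -EFinM lee_fin exprSr; lra.
  rewrite [leRHS]integral_mkcond; apply: ge0_le_integral => //.
  - set P := (fun p : R * 'rV[R]_n => rv_cons p.1 p.2) @^-1`
       (@cube n.+1 `&` slab a t kap).
    have mP : measurable P.
      by rewrite -[X in measurable X]setTI; exact: measurable_rv_cons.
    rewrite [X in measurable_fun _ X](_ : _ = @lebesgue_rv R n \o xsection P).
      exact: measurable_fun_xsection.
    apply/funext => x /=; congr (lebesgue_rv _).
    by apply/seteqP; split => w; rewrite /xsection/= ?inE.
  - by apply/(measurable_restrictT _ _).1 => //; exact: measurable_cst.
  move=> x _; rewrite patchE; case: ifPn => hx.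
    have := IH (rv_uncons a).2 (a ord0 ord0 * x + t)%R j.
    rewrite mxE => /(_ ai0); apply: le_trans; apply: le_measure; rewrite ?inE.
    - rewrite -[X in measurable X]setTI.
      exact: (@measurable_rv_cons1 n x measurableT _ mcs).
    - by apply: measurableI; [exact: measurable_cube|exact: measurable_slab].
    - move=> w /= [/cube_rv_cons[_ ?]]; rewrite /slab/= dotv_rv_cons => h.
      by split=> //=; rewrite addrA [(dotv _ _ + _)%R]addrC.
  rewrite (_ : [set w | _] = set0) ?measure0//.
  apply/seteqP; split=> w //= -[/cube_rv_cons[h _] _].
  by move/negP : hx; apply; rewrite inE/= in_itv/= -ler_norml.
pose m : {sigma_finite_measure set 'rV[R]_n -> \bar R} := @lebesgue_rv R n.
rewrite /= (cavalieriE m).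
set P := _ @^-1` _.
have mP : measurable P.
  by rewrite -[X in measurable X]setTI; exact: measurable_rv_cons.
(* Here the good coordinate is the first one, which [cavalieri] integrates last. Uniqueness of the
   product measure exchanges the order, so that it is integrated first, at fixed [w]. *)
have -> : (lebesgue_measure \x m) P = (lebesgue_measure \x^ m) P.
  by apply: product_measure_unique => //= A B mA mB; rewrite product_measure2E.
apply: (@le_trans _ _ (\int[m]_(w in @cube n)
    (2 * (kap / `|a ord0 ord0|))%:E)); last first.
  rewrite integral_cst; last exact: measurable_cube.
  rewrite exprSr -mulrA (EFinM (2 ^+ n)) muleC; apply: lee_wpmul2r.
    by rewrite lee_fin mulr_ge0// divr_ge0.
  exact: lebesgue_rv_cube.
rewrite [leRHS]integral_mkcond; apply: ge0_le_integral => //.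
- exact: measurable_fun_ysection.
- apply/(measurable_restrictT _ _).1; first exact: measurable_cube.
  exact: measurable_cst.
move=> w _; rewrite patchE; case: ifPn => hw.
  rewrite -(lebesgue_measure_slab (dotv (rv_uncons a).2 w + t))//=.
  apply: le_measure; rewrite ?inE.
  - exact: measurable_ysection.
  - rewrite (_ : [set x | _] =
        (fun x => a ord0 ord0 * x + (dotv (rv_uncons a).2 w + t))%R @^-1`
        `[(- kap)%R, kap]).
      rewrite -[X in measurable X]setTI.
      by apply: measurable_funD => //; exact: measurable_funM.
    by apply/seteqP; split => x /=; rewrite in_itv/= -ler_norml.
  - move=> x; rewrite /ysection/= inE => -[_].
    by rewrite /slab/= dotv_rv_cons addrA.
rewrite /= (_ : ysection P w = set0) ?measure0//.
apply/seteqP; split=> x; rewrite /ysection/= inE//= => -[/cube_rv_cons[_ h] _].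
by move/negP : hw; apply; rewrite inE.
Qed.

End slab_volume.

(** * Euclidean inner product and unit vectors *)

Section dot_product.
Context {R : realType} {n : nat}.
Implicit Types (x y z : 'rV[R]_n) (c : R).

Lemma dotvC x y : dotv x y = dotv y x.
Proof. by apply: eq_bigr => i _; rewrite mulrC. Qed.

Lemma dotvDl x y z : dotv (x + y) z = dotv x z + dotv y z.
Proof. by rewrite -big_split; apply: eq_bigr => i _; rewrite mxE mulrDl. Qed.

Lemma dotvZl c x y : dotv (c *: x) y = c * dotv x y.
Proof. by rewrite mulr_sumr; apply: eq_bigr => i _; rewrite mxE mulrA. Qed.

Lemma dotvNl x y : dotv (- x) y = - dotv x y.
Proof. by rewrite -scaleN1r dotvZl mulN1r. Qed.

Lemma dotvDr x y z : dotv z (x + y) = dotv z x + dotv z y.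
Proof. by rewrite dotvC dotvDl !(dotvC z). Qed.

Lemma dotvZr c x y : dotv y (c *: x) = c * dotv y x.
Proof. by rewrite dotvC dotvZl (dotvC y). Qed.

Lemma dotvNr x y : dotv y (- x) = - dotv y x.
Proof. by rewrite dotvC dotvNl (dotvC y). Qed.

Definition dotvE := (dotvDl, dotvDr, dotvNl, dotvNr, dotvZl, dotvZr).

Lemma dotvv_ge0 x : 0 <= dotv x x.
Proof. by apply: sumr_ge0 => i _; rewrite -expr2 sqr_ge0. Qed.

Lemma dotvv_eq0 x : (dotv x x == 0) = (x == 0).
Proof.
apply/eqP/eqP => [|->]; last by apply: big1 => i _; rewrite mxE mul0r.
move/psumr_eq0P => h; apply/rowP => i; rewrite mxE.
by apply/eqP; rewrite -sqrf_eq0 expr2 h// => j _; rewrite -expr2 sqr_ge0.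
Qed.

Lemma dotvv_gt0 x : (0 < dotv x x) = (x != 0).
Proof. by rewrite lt_def dotvv_ge0 andbT dotvv_eq0. Qed.

Lemma cauchy_schwarz x y : dotv x y ^+ 2 <= dotv x x * dotv y y.
Proof.
have [/eqP|y0] := eqVneq (dotv y y) 0.
  rewrite dotvv_eq0 => /eqP ->.
  rewrite -(scale0r 0) dotvZr mul0r expr0n mulr_ge0 ?dotvv_ge0//.
have yp : 0 < dotv y y by rewrite lt_def y0 dotvv_ge0.
have := dotvv_ge0 (dotv y y *: x - dotv x y *: y).
rewrite !dotvE (dotvC y x) => h.
rewrite -subr_ge0 -(pmulr_rge0 _ yp).
by apply: le_trans h _; rewrite le_eqVlt; apply/orP; left; apply/eqP; ring.
Qed.

Lemma enorm_sqr x : enorm x ^+ 2 = dotv x x.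
Proof. by rewrite sqr_sqrtr// dotvv_ge0. Qed.

Lemma usphereE x : usphere R n x <-> dotv x x = 1.
Proof.
rewrite /usphere/=; split=> [h|h]; first by rewrite -enorm_sqr h expr1n.
by rewrite /enorm h sqrtr1.
Qed.

Lemma japanese_sqr x : japanese x ^+ 2 = 1 + dotv x x.
Proof. by rewrite sqr_sqrtr ?enorm_sqr// addr_ge0// dotvv_ge0. Qed.

Lemma normalize_usphere x : x != 0 -> usphere R n ((enorm x)^-1 *: x).
Proof.
rewrite -dotvv_gt0 => x0; apply/usphereE; rewrite dotvZl dotvZr -enorm_sqr.
by rewrite mulrA -expr2 -exprMn mulVf ?expr1n// gt_eqF// sqrtr_gt0.
Qed.

Lemma dotv_delta (i : 'I_n) x : dotv (delta_mx ord0 i) x = x ord0 i.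
Proof.
rewrite /dotv (bigD1 i)//= mxE !eqxx mul1r big1 ?addr0// => j ji.
by rewrite mxE (negbTE ji) andbF mul0r.
Qed.

Lemma delta_usphere (i : 'I_n) : usphere R n (delta_mx ord0 i).
Proof. by apply/usphereE; rewrite dotv_delta mxE !eqxx. Qed.

(** Two coordinates suffice: either the first entry of [x] vanishes and the first basis vector
    works, or the first two entries are rotated by a right angle. *)
Lemma exists_orthogonal_unit x : (1 < n)%N ->
  exists e : 'rV[R]_n, usphere R n e /\ dotv e x = 0.
Proof.
move=> n1; suff [z [z0 zx]] : exists z, z != 0 /\ dotv z x = 0.
  exists ((enorm z)^-1 *: z); split; first exact: normalize_usphere.
  by rewrite dotvZl zx mulr0.
pose i : 'I_n := Ordinal (ltnW n1); pose j : 'I_n := Ordinal n1.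
have [xi0|xi0] := eqVneq (x ord0 i) 0.
  exists (delta_mx ord0 i); rewrite dotv_delta; split=> //.
  apply/eqP => /rowP/(_ i); rewrite !mxE !eqxx => /eqP.
  by rewrite oner_eq0.
exists (x ord0 j *: delta_mx ord0 i - x ord0 i *: delta_mx ord0 j).
split; last by rewrite dotvDl dotvNl !dotvZl !dotv_delta mulrC subrr.
apply/eqP => /rowP/(_ j); rewrite !mxE !eqxx/=.
by rewrite mulr0 mulr1 sub0r => /eqP; rewrite oppr_eq0 (negbTE xi0).
Qed.

(* [om] is nearly parallel to [w] unless [w] is short. *)
Lemma near_line (w om e : 'rV[R]_n) c r :
  dotv om om = 1 -> dotv e e = 1 -> dotv e w = 0 ->
  dotv (w - c *: om) (w - c *: om) <= r ->
  [/\ c ^+ 2 * dotv e om ^+ 2 <= r, dotv w w <= 2 * r + 2 * c ^+ 2 &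
      c ^+ 2 <= 2 * r + 2 * dotv w w].
Proof.
move=> om1 e1 ew hr; split.
- apply: le_trans hr; have := cauchy_schwarz e (w - c *: om).
  by rewrite e1 mul1r dotvDr ew dotvNr dotvZr add0r sqrrN exprMn.
- have := dotvv_ge0 (w - (2 * c) *: om); move: hr.
  rewrite !dotvE om1 (dotvC om w); nra.
- have := dotvv_ge0 (2 *: w - c *: om); move: hr.
  rewrite !dotvE om1 (dotvC om w); nra.
Qed.

(** Pigeonhole on the squares. Since every entry has absolute value at most 1, its square is at most
    its absolute value, which gives the threshold 1/n without a square root. *)
Lemma usphere_coord e : usphere R n e -> exists i, n%:R^-1 <= `|e ord0 i|.
Proof.
move/usphereE => e1; apply/not_existsP => h.
have n0 : (0 < n)%N.
  case: n e e1 {h} => // e /eqP; rewrite /dotv big_ord0 eq_sym oner_eq0//.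
have nR : 0 < n%:R :> R by rewrite ltr0n.
have le1 i : `|e ord0 i| <= 1.
  rewrite -(@ler_pXn2r _ 2) ?nnegrE// expr1n real_normK ?num_real//.
  rewrite -e1 /dotv (bigD1 i)//= -expr2 lerDl.
  by apply: sumr_ge0 => j _; rewrite -expr2 sqr_ge0.
have : dotv e e < \sum_(i < n) n%:R^-1.
  apply: ltr_sum; first by apply/hasP; exists (Ordinal n0) => //; rewrite mem_index_enum.
  move=> i _; apply: (@le_lt_trans _ _ `|e ord0 i|).
    by rewrite -expr2 -real_normK ?num_real// expr2 ler_piMr.
  by rewrite ltNge; apply/negP; exact: h.
by rewrite e1 sumr_const card_ord -[X in _ < X]mulr_natl mulfV ?gt_eqF// ltxx.
Qed.

End dot_product.

(** * Surface measure of slabs on the sphere *)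

Section sphere_slab.
Context {R : realType} {n : nat}.
Local Open Scope ereal_scope.

Lemma measurable_cone (A : set 'rV[R]_n) : measurable A ->
  measurable [set x : 'rV[R]_n | (0 < enorm x <= 1)%R /\ A ((enorm x)^-1 *: x)%R].
Proof.
move=> mA; rewrite (_ : [set x | _] = enorm @^-1` `]0%R, 1%R] `&`
    (fun x => (enorm x)^-1 *: x)%R @^-1` A); last first.
  by apply/seteqP; split => x /=; rewrite in_itv.
apply: measurableI.
  by rewrite -[X in measurable X]setTI; exact: measurable_enorm.
by rewrite -[X in measurable X]setTI; exact: measurable_normalize.
Qed.

(** Scaling by a factor at most 1 keeps a point in a slab centred at 0, so the truncated cone lies
    in the slab intersected with the cube. One factor [n] normalizes the surface measure, the other
    bounds [1 / |e_i|] for a large entry of [e]. *)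
Lemma sphere_measure_slab (e : 'rV[R]_n) (kap : R) :
  usphere R n e -> (0 <= kap)%R ->
  sphere_measure (slab e 0 kap) <= (n%:R ^+ 2 * 2 ^+ n * kap)%:E.
Proof.
move=> he k0; have [i hi] := usphere_coord he.
have n0 : (0 < n%:R :> R)%R by rewrite ltr0n (leq_ltn_trans _ (ltn_ord i)).
have ei : (0 < `|e ord0 i|)%R by apply: lt_le_trans hi; rewrite invr_gt0.
rewrite /sphere_measure.
apply: (@le_trans _ _ (n%:R%:E * (2 ^+ n * (kap / `|e ord0 i|))%:E)).
  apply: lee_wpmul2l; first by rewrite lee_fin.
  apply: le_trans (lebesgue_rv_slab 0 _ k0); last by rewrite -normr_gt0.
  apply: le_measure; rewrite ?inE.
  - by apply: measurable_cone; exact: measurable_slab.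
  - by apply: measurableI; [exact: measurable_cube|exact: measurable_slab].
  - move=> x [/andP[x0 x1] /=]; rewrite /slab/= dotvZr !addr0 => h; split.
      move=> j; rewrite -(@ler_pXn2r _ 2) ?nnegrE// expr1n real_normK ?num_real//.
      apply: (@le_trans _ _ (enorm x ^+ 2)%R); last by rewrite exprn_ile1// ltW.
      rewrite enorm_sqr /dotv (bigD1 j)//= -expr2 lerDl.
      by apply: sumr_ge0 => k _; rewrite -expr2 sqr_ge0.
    move: h; rewrite normrM ger0_norm ?invr_ge0 ?sqrtr_ge0// ler_pdivrMl// => h.
    by apply: le_trans h _; rewrite -[leRHS]mul1r ler_wpM2r.
rewrite -EFinM lee_fin expr2 -!mulrA ler_wpM2l ?ler0n//.
rewrite [leRHS]mulrCA ler_wpM2l ?exprn_ge0// mulrC ler_wpM2r//.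
by rewrite -[leRHS]invrK lef_pV2// posrE invr_gt0.
Qed.

End sphere_slab.

(** * Energy conservation and the geometry of concentrated collisions *)

Section ternary_geometry.
Context {R : realType} {d : nat}.
Implicit Types (v : 'rV[R]_d) (om u w : 'rV[R]_(d + d)).

Lemma dotv_row_mx (x y z t : 'rV[R]_d) :
  dotv (row_mx x y) (row_mx z t) = dotv x z + dotv y t.
Proof.
rewrite /dotv big_split_ord/=; congr (_ + _); apply: eq_bigr => i _.
  by rewrite !row_mxEl.
by rewrite !row_mxEr.
Qed.

Lemma dotv_hsubmx u w :
  dotv u w = dotv (lsubmx u) (lsubmx w) + dotv (rsubmx u) (rsubmx w).
Proof. by rewrite -dotv_row_mx !hsubmxK. Qed.

Lemma usphere_hsubmx om : usphere R (d + d) om ->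
  dotv (lsubmx om) (lsubmx om) + dotv (rsubmx om) (rsubmx om) = 1.
Proof. by move/usphereE; rewrite dotv_hsubmx. Qed.

Lemma dotv_hsubmx_bound om : usphere R (d + d) om ->
  - (1 / 2) <= dotv (lsubmx om) (rsubmx om) <= 1 / 2.
Proof.
move/usphere_hsubmx => h.
have := dotvv_ge0 (lsubmx om + rsubmx om).
have := dotvv_ge0 (lsubmx om - rsubmx om).
rewrite !dotvE (dotvC (rsubmx om) (lsubmx om)) => h1 h2.
by apply/andP; split; lra.
Qed.

Lemma coll_coefE om v v1 v2 : usphere R (d + d) om ->
  coll_coef om v v1 v2 * (1 + dotv (lsubmx om) (rsubmx om)) =
  dotv (rel_velocity v v1 v2) om.
Proof.
move/dotv_hsubmx_bound => h; rewrite /coll_coef divfK// gt_eqF//.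
by move: h => /andP[h _]; lra.
Qed.

Lemma ternary_energyE v v1 v2 :
  ternary_energy v v1 v2 = 3 + (dotv v v + dotv v1 v1 + dotv v2 v2).
Proof. by rewrite /ternary_energy !japanese_sqr; ring. Qed.

Lemma star_energy om v v1 v2 : usphere R (d + d) om ->
  ternary_energy (vstar om v v1 v2) (v1star om v v1 v2) (v2star om v v1 v2) =
  ternary_energy v v1 v2.
Proof.
move=> hom; have c2 := coll_coefE v v1 v2 hom.
have h := usphere_hsubmx hom.
move: c2; rewrite !ternary_energyE /vstar /v1star /v2star.
rewrite dotv_hsubmx row_mxKl row_mxKr.
set c := coll_coef _ _ _ _; move: (lsubmx om) (rsubmx om) h => a b h.
rewrite !dotvE (dotvC a v) (dotvC a v1) (dotvC b v) (dotvC b v2) (dotvC b a).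
move=> c2.
(* The two added terms vanish, the first by the formula for the collision coefficient and the second
   by [|om| = 1]; they are exactly the energy difference. *)
have -> : 3 + (dotv v v + dotv v1 v1 + dotv v2 v2) =
   3 + (dotv v v + dotv v1 v1 + dotv v2 v2)
   + 2 * c * (c * (1 + dotv a b) - (dotv v1 a - dotv v a + (dotv v2 b - dotv v b)))
   + 2 * c ^+ 2 * ((dotv a a + dotv b b) - 1).
  by rewrite c2 h; ring.
by ring.
Qed.

(** If [w] is long, [om] is nearly parallel to it, hence nearly orthogonal to any [e] orthogonal to
    [w]. If [w] is short, so is [c], hence [dotv u om] is small while [u] must carry the energy. The
    vector [e] is fixed before [om], so each alternative is a slab. *)
Lemma nearly_parallel u w (E kap : R) : (0 < d)%N -> 0 < kap <= 1 ->
  E - 3 <= 2 * dotv u u + 7 * dotv w w ->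
  exists2 e : 'rV[R]_(d + d), usphere R (d + d) e &
    forall om c, usphere R (d + d) om ->
      c * (1 + dotv (lsubmx om) (rsubmx om)) = dotv u om ->
      2 <= (kap ^+ 2 / 20) ^+ 2 * E ->
      dotv (w - c *: om) (w - c *: om) <= 3 * (kap ^+ 2 / 20) ^+ 2 * E ->
      dotv e om ^+ 2 <= kap ^+ 2 \/
      dotv u om ^+ 2 <= kap ^+ 2 * dotv u u.
Proof.
move=> d0 /andP[k0 k1] hE.
have [|e [he ew]] := @exists_orthogonal_unit R (d + d) w.
  by case: (d) d0 => // k _; rewrite addSn addnS.
exists e => // om c hom hc hE2 hr.
have /andP[g1 g2] := dotv_hsubmx_bound hom.
have [h1 h2 h3] := near_line ((usphereE _).1 hom) ((usphereE _).1 he) ew hr.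
move: hE2 h1 h2 h3 hE hr; rewrite -hc.
set g := dotv (lsubmx om) _ in g1 g2 *.
have W0 := dotvv_ge0 w; have U0 := dotvv_ge0 u.
move: (dotv w w) (dotv u u) W0 U0 => W U W0 U0.
have Y0 : 0 <= dotv e om ^+ 2 by exact: sqr_ge0.
move: (dotv e om ^+ 2) Y0 => Y Y0 hE2 h1 h2 h3 hE _.
have X0 : 0 <= c ^+ 2 by exact: sqr_ge0.
rewrite exprMn; have G : (1 + g) ^+ 2 <= 9 / 4.
  have -> : 9 / 4 = (3 / 2) ^+ 2 :> R by field.
  by rewrite ler_pXn2r ?nnegrE//; lra.
have G0 : 0 <= (1 + g) ^+ 2 by exact: sqr_ge0.
move: ((1 + g) ^+ 2) G G0 => G hG G0.
move: (c ^+ 2) X0 h1 h2 h3 hE2 hE => X X0.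
have K0 : 0 < kap ^+ 2 by rewrite exprn_gt0.
have K1 : kap ^+ 2 <= 1 by rewrite exprn_ile1// ltW.
have [J [J0 J1 KJ]] : exists J : R, [/\ 0 < J, J <= 1 / 20 & kap ^+ 2 = 20 * J].
  by exists (kap ^+ 2 / 20); split; lra.
have -> : kap ^+ 2 / 20 = J by rewrite KJ; field.
rewrite KJ expr2 => h1 h2 h3 hE2 hE.
have JJ : 0 < J * J by rewrite mulr_gt0.
have E0 : 0 < E by rewrite -(pmulr_rgt0 _ JJ); lra.
have JE0 : 0 < J * E by rewrite mulr_gt0.
have JJE : J * J * E <= 1 / 20 * (J * E) by rewrite mulrA ler_pM2r// ler_pM2r.
have JE1 : J * E <= 1 / 20 * E by rewrite ler_pM2r.
(* The threshold [J * E] dominates the error [3 * J^2 * E] because [J <= 1/20]; this leaves [c^2] at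
   least [0.35 J E] in the first case and at most [2.3 J E] in the second. There [2 <= J^2 * E]
   absorbs the constant 3 in the energy hypothesis. *)
have [hW|hW] := leP (J * E) W; [left|right].
  have hX : 35 / 100 * (J * E) <= X by lra.
  have h : 35 / 100 * (J * E) * Y <= 3 * (J * J * E).
    by apply: (@le_trans _ _ (X * Y)); [rewrite ler_wpM2r|lra].
  have JJE0 : 0 < J * (J * E) by rewrite mulr_gt0.
  by rewrite -(ler_pM2r JE0); lra.
have hX : X <= 23 / 10 * (J * E) by lra.
have hU : 3 / 10 * E <= U by lra.
have hXG : X * G <= 9 / 4 * X by rewrite mulrC ler_wpM2r.
apply: (le_trans hXG); apply: (@le_trans _ _ (20 * J * (3 / 10 * E))); last first.
  by rewrite ler_pM2l//; lra.
lra.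
Qed.

(** The three vectors are the values that [c *: om] would take if two of the outgoing velocities
    vanished. None can be short together with the relative velocity unless the energy is small; each
    inequality is a nonnegative combination of the squares listed in the proof. *)
Lemma ternary_energy_gap v v1 v2 :
  [/\ ternary_energy v v1 v2 - 3 <=
        2 * dotv (rel_velocity v v1 v2) (rel_velocity v v1 v2) +
        7 * dotv (row_mx v1 v2) (row_mx v1 v2),
      ternary_energy v v1 v2 - 3 <=
        2 * dotv (rel_velocity v v1 v2) (rel_velocity v v1 v2) +
        7 * dotv (row_mx (- (v + v2)) v2) (row_mx (- (v + v2)) v2) &
      ternary_energy v v1 v2 - 3 <=
        2 * dotv (rel_velocity v v1 v2) (rel_velocity v v1 v2) +
        7 * dotv (row_mx v1 (- (v + v1))) (row_mx v1 (- (v + v1)))].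
Proof.
rewrite ternary_energyE !dotv_row_mx.
have := dotvv_ge0 (2 *: v1 - v); have := dotvv_ge0 (v1 - 2 *: v).
have := dotvv_ge0 (v2 - 2 *: v); have := dotvv_ge0 (v + 2 *: v2).
have := dotvv_ge0 (v + 2 *: v1); have := dotvv_ge0 (v2 - v).
have := dotvv_ge0 (v1 - v); have := dotvv_ge0 (v + v1).
have := dotvv_ge0 (v + v2).
have := dotvv_ge0 v; have := dotvv_ge0 v1; have := dotvv_ge0 v2.
rewrite !dotvE (dotvC v1 v) (dotvC v2 v).
by move=> *; split; lra.
Qed.

End ternary_geometry.

(** * The exceptional directions and their measure *)

Section exceptional_set.
Context {R : realType} {d : nat}.
Implicit Types (v : 'rV[R]_d) (om u w : 'rV[R]_(d + d)).

(* Momentum is conserved, so two slow outgoing particles determine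
   [c *: om] up to a small error by the incoming velocities alone. *)
Lemma concentrated_error v v1 v2 om :
  let c := coll_coef om v v1 v2 in
  let s0 := dotv (vstar om v v1 v2) (vstar om v v1 v2) in
  let s1 := dotv (v1star om v v1 v2) (v1star om v v1 v2) in
  let s2 := dotv (v2star om v v1 v2) (v2star om v v1 v2) in
  let err w := dotv (w - c *: om) (w - c *: om) in
  [/\ err (row_mx v1 v2) <= 3 * (s1 + s2),
      err (row_mx (- (v + v2)) v2) <= 3 * (s0 + s2) &
      err (row_mx v1 (- (v + v1))) <= 3 * (s0 + s1)].
Proof.
rewrite /= /vstar /v1star /v2star; move: (coll_coef _ _ _ _) => c.
set a := lsubmx om; set b := rsubmx om.
have E x y : dotv (row_mx x y - c *: om) (row_mx x y - c *: om) =
    dotv (x - c *: a) (x - c *: a) + dotv (y - c *: b) (y - c *: b).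
  by rewrite -{1 2}(hsubmxK om) scale_row_mx opp_row_mx add_row_mx dotv_row_mx.
rewrite !E.
(* Momentum conservation: this component of the error is minus the sum of two outgoing velocities,
   and likewise below. *)
have -> : - (v + v2) - c *: a = - ((v + c *: (a + b)) + (v2 - c *: b)).
  by rewrite scalerDr; apply/rowP => i; rewrite !mxE; ring.
have -> : - (v + v1) - c *: b = - ((v + c *: (a + b)) + (v1 - c *: a)).
  by rewrite scalerDr; apply/rowP => i; rewrite !mxE; ring.
move: (v + _) (v1 - _) (v2 - _) => x y z.
have := dotvv_ge0 (x - y); have := dotvv_ge0 (x - z).
have := dotvv_ge0 x; have := dotvv_ge0 y; have := dotvv_ge0 z.
rewrite !dotvE (dotvC y x) (dotvC z x).
by move=> *; split; lra.
Qed.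

Lemma exists_exceptional_slabs (kap : R) : (0 < d)%N -> 0 < kap <= 1 ->
  exists2 del : R, 0 < del < 1 &
  forall v v1 v2, rel_velocity v v1 v2 != 0 ->
  exists2 e : nat -> 'rV[R]_(d + d), (forall i, (i < 4)%N -> usphere R (d + d) (e i)) &
  forall om, usphere R (d + d) om ->
    (forall i, (i < 4)%N -> ~ slab (e i) 0 kap om) ->
    [/\ japanese (vstar om v v1 v2) ^+ 2 <= (1 - del) * ternary_energy v v1 v2,
        japanese (v1star om v v1 v2) ^+ 2 <= (1 - del) * ternary_energy v v1 v2 &
        japanese (v2star om v v1 v2) ^+ 2 <= (1 - del) * ternary_energy v v1 v2].
Proof.
move=> d0 hk; have /andP[k0 k1] := hk.
(* This is the energy fraction that appears in [nearly_parallel]. *)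
exists ((kap ^+ 2 / 20) ^+ 2).
  rewrite exprn_gt0 ?divr_gt0 ?exprn_gt0//= -[ltRHS](expr1n _ 2).
  rewrite ltr_pXn2r ?nnegrE ?divr_ge0 ?exprn_ge0 ?ltW//.
  have : kap ^+ 2 <= 1 by rewrite exprn_ile1// ltW.
  lra.
move=> v v1 v2 u0.
have [G0 G1 G2] := ternary_energy_gap v v1 v2.
have [e0 he0 H0] := nearly_parallel d0 hk G0.
have [e1 he1 H1] := nearly_parallel d0 hk G1.
have [e2 he2 H2] := nearly_parallel d0 hk G2.
pose u := rel_velocity v v1 v2; pose e3 := (enorm u)^-1 *: u.
(* One slab for each particle that may carry almost all the energy, and one orthogonal to the
   relative velocity, common to the three cases with short [w]. *)
exists (nth e0 [:: e0; e1; e2; e3]).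
  by move=> [|[|[|[|//]]]] //= _; exact: normalize_usphere.
move=> om hom S.
have sqr_slab e : dotv e om ^+ 2 <= kap ^+ 2 -> slab e 0 kap om.
  by rewrite /slab/= addr0 -[dotv e om ^+ 2]real_normK ?num_real//
    ler_pXn2r ?nnegrE// ltW.
have u_slab : dotv u om ^+ 2 <= kap ^+ 2 * dotv u u -> False.
  move=> h; apply: (S 3) => //; apply: sqr_slab; rewrite /= dotvZl exprMn exprVn.
  by rewrite enorm_sqr ler_pdivrMl ?dotvv_gt0// mulrC.
have E := star_energy v v1 v2 hom.
have [r0 r1 r2] := concentrated_error v v1 v2 om.
have cE := coll_coefE v v1 v2 hom.
rewrite -E ternary_energyE in H0 H1 H2 *; rewrite !japanese_sqr.
have := dotvv_ge0 (vstar om v v1 v2).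
have := dotvv_ge0 (v1star om v v1 v2).
have := dotvv_ge0 (v2star om v v1 v2).
move: H0 H1 H2 r0 r1 r2; set del := (_ / 20) ^+ 2.
move: (dotv (vstar _ _ _ _) _) (dotv (v1star _ _ _ _) _) (dotv (v2star _ _ _ _) _).
move=> s0 s1 s2 H0 H1 H2 r0 r1 r2 p2 p1 p0.
(* If one particle exceeds [(1 - del) E], the other two share less than [del E]. As each squared
   bracket is at least 1, this yields both [2 <= del E] and the error bound [3 del E]. *)
split; rewrite leNgt; apply/negP => h.
- have [| |/sqr_slab h1|//] := H0 om _ hom cE; [lra|lra|].
  exact: (S 0).
- have [| |/sqr_slab h1|//] := H1 om _ hom cE; [lra|lra|].
  exact: (S 1).
- have [| |/sqr_slab h1|//] := H2 om _ hom cE; [lra|lra|].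
  exact: (S 2).
Qed.

(** The order of the quantifiers carries the uniformity: the set moves with the incoming velocities,
    while [del] does not. *)
Lemma exists_exceptional_set (eps : R) : (0 < d)%N -> 0 < eps ->
  exists2 del : R, 0 < del < 1 &
  forall v v1 v2, rel_velocity v v1 v2 != 0 ->
  exists B : set 'rV[R]_(d + d),
    [/\ measurable B, (sphere_measure B <= eps%:E)%E &
    forall om, usphere R (d + d) om -> ~ B om ->
    [/\ japanese (vstar om v v1 v2) ^+ 2 <= (1 - del) * ternary_energy v v1 v2,
        japanese (v1star om v v1 v2) ^+ 2 <= (1 - del) * ternary_energy v v1 v2 &
        japanese (v2star om v v1 v2) ^+ 2 <= (1 - del) * ternary_energy v v1 v2]].
Proof.
move=> d0 eps0; pose C : R := (d + d)%:R ^+ 2 * 2 ^+ (d + d).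
have C0 : 0 < C by rewrite mulr_gt0 ?exprn_gt0// ltr0n addn_gt0 d0.
(* Each of the four slabs has measure at most [C * kap]. *)
pose kap := Num.min 1 (eps / (4 * C)).
have k0 : 0 < kap by rewrite lt_min ltr01 divr_gt0// mulr_gt0.
have k1 : 0 < kap <= 1 by rewrite k0 ge_min lexx.
have kC : kap * (4 * C) <= eps.
  rewrite -ler_pdivlMr; last by rewrite mulr_gt0.
  by rewrite /kap ge_min lexx orbT.
have [del hdel H] := exists_exceptional_slabs d0 k1.
exists del => // v v1 v2 u0; have [e he hB] := H v v1 v2 u0.
exists (\big[setU/set0]_(i < 4) slab (e i) 0 kap); split.
- by apply: bigsetU_measurable => i _; exact: measurable_slab.
- apply: le_trans (@Boole_inequality _ _ _ _ (fun i => slab (e i) 0 kap) 4 _) _.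
    by move=> i _; exact: measurable_slab.
  apply: (@le_trans _ _ (\sum_(i < 4) (C * kap)%:E)%E).
    by apply: lee_sum => i _; apply: sphere_measure_slab; [exact: he|exact: ltW].
  rewrite sumEFin sumr_const card_ord lee_fin; apply: le_trans kC.
  by rewrite -[leLHS]mulr_natr; lra.
- move=> om hom nB; apply: hB => // i i4 hi; apply: nB.
  by rewrite -(bigcup_mkord 4 (fun i => slab (e i) 0 kap)); exists i.
Qed.

End exceptional_set.

(* Unlike [ge0_le_integral], no measurability of the smaller function. *)
Lemma ge0_le_integral_lower d (T : measurableType d) (R : realType)
    (mu : {measure set T -> \bar R}) (D : set T) (f g : T -> \bar R) :
  (forall x, D x -> 0 <= f x)%E -> (forall x, D x -> f x <= g x)%E ->
  (\int[mu]_(x in D) f x <= \int[mu]_(x in D) g x)%E.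
Proof.
move=> f0 fg; have g0 x : D x -> (0 <= g x)%E.
  by move=> Dx; exact: le_trans (f0 _ Dx) (fg _ Dx).
rewrite !ge0_integralE//; apply: ereal_sup_le => _ [h hf <-].
exists h => // x; apply: le_trans (hf x) _.
by apply: lee_restrict.
Qed.

(** * Integrability of the angular factor *)

Section angular_kernel.
Context {R : realType} {d : nat}.
Variables (b3 : R -> R -> R) (theta : R) (phi : R -> R).
Hypothesis d0 : (0 < d)%N.
Hypothesis theta0 : 0 <= theta.
Hypothesis mphi : measurable_fun setT (phi \_ `[- (1 / 2), 1 / 2]).
Hypothesis b3E : forall x y : R, -1 <= x <= 1 -> - (1 / 2) <= y <= 1 / 2 ->
  b3 x y = `|x| `^ theta * phi y.
Hypothesis b3_ge0 : forall x y : R, -1 <= x <= 1 -> - (1 / 2) <= y <= 1 / 2 ->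
  0 <= b3 x y.
Hypothesis cutoff : forall e : 'rV[R]_(d + d), usphere R (d + d) e ->
  (b3_norm b3 e < +oo)%E.

Local Notation S := (usphere R (d + d)).
Local Notation mu := (@sphere_measure R (d + d)).

(** Restricting [phi] makes the function measurable on the whole space and changes nothing on the
    sphere, where the inner product of the two halves stays in the interval. *)
Definition angular (om : 'rV[R]_(d + d)) : R :=
  (phi \_ `[- (1 / 2), 1 / 2]) (dotv (lsubmx om) (rsubmx om)).

Lemma measurable_usphere : measurable S.
Proof.
rewrite (_ : S = enorm @^-1` [set 1])//.
by rewrite -[X in measurable X]setTI; exact: measurable_enorm.
Qed.

Lemma measurable_angular : measurable_fun setT angular.
Proof.
apply: (measurableT_comp mphi).
rewrite (_ : (fun _ => _) = (fun om => \sum_(i < d)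
    rv_coord (lshift d i) om * rv_coord (rshift d i) om)).
  by apply: measurable_sum => i; apply: measurable_funM; exact: measurable_rv_coord.
by apply/funext => om; apply: eq_bigr => i _; rewrite !mxE.
Qed.

Lemma angularE om : S om -> angular om = phi (dotv (lsubmx om) (rsubmx om)).
Proof.
move=> hom; rewrite /angular patchE mem_set//=.
by rewrite in_itv/=; exact: dotv_hsubmx_bound.
Qed.

Lemma angular_ge0 om : S om -> 0 <= angular om.
Proof.
move=> hom; rewrite angularE//.
(* At [x = 1] the kernel reduces to [phi], which thus inherits its sign. *)
have h1 : -1 <= (1 : R) <= 1 by rewrite -ler_norml normr1.
have := b3_ge0 h1 (dotv_hsubmx_bound hom).
by rewrite b3E ?dotv_hsubmx_bound// normr1 powR1 mul1r.
Qed.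

Lemma dotv_bound (a om : 'rV[R]_(d + d)) : dotv a a <= 1 -> S om ->
  -1 <= dotv a om <= 1.
Proof.
move=> a1 /usphereE om1; rewrite -ler_norml.
rewrite -(@ler_pXn2r _ 2) ?nnegrE// expr1n real_normK ?num_real//.
by apply: le_trans (cauchy_schwarz _ _) _; rewrite om1 mulr1.
Qed.

Lemma b3_angular (a om : 'rV[R]_(d + d)) : dotv a a <= 1 -> S om ->
  b3 (dotv a om) (dotv (lsubmx om) (rsubmx om)) =
  `|dotv a om| `^ theta * angular om.
Proof.
move=> a1 hom.
by rewrite b3E ?dotv_bound ?dotv_hsubmx_bound// angularE.
Qed.

Lemma measurable_angular_kernel (a : 'rV[R]_(d + d)) :
  measurable_fun setT (fun om => `|dotv a om| `^ theta * angular om).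
Proof.
apply: measurable_funM; last exact: measurable_angular.
apply: (measurableT_comp (measurable_powR _)).
apply: measurableT_comp => //; exact: measurable_dotv.
Qed.

Lemma b3_normE (e : 'rV[R]_(d + d)) : S e ->
  b3_norm b3 e =
  (\int[mu]_(om in S) (`|dotv e om| `^ theta * angular om)%:E)%E.
Proof.
move=> he; apply: eq_integral => om; rewrite inE => hom.
by rewrite b3_angular// (usphereE e).1.
Qed.

(* Some coordinate of a unit vector is at least [1 / n] in absolute value, so
   the weight [|x|^theta] of the cut-off condition can be removed. *)
Lemma angular_le_sum om : S om -> angular om <=
  (d + d)%:R `^ theta *
  \sum_(i < d + d) `|dotv (delta_mx ord0 i) om| `^ theta * angular om.
Proof.
move=> hom; have [i hi] := usphere_coord hom.
have n0 : 0 < (d + d)%:R :> R by rewrite ltr0n addn_gt0 d0.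
have A0 := angular_ge0 hom.
rewrite (bigD1 i)//= mulrDr; apply: ler_wpDr.
  rewrite mulr_ge0 ?powR_ge0//; apply: sumr_ge0 => j _.
  by rewrite mulr_ge0 ?powR_ge0.
rewrite mulrA -powRM ?ler0n// -[leLHS]mul1r ler_wpM2r//.
rewrite dotv_delta; apply: (@le_trans _ _ (1 `^ theta)); first by rewrite powR1.
apply: ge0_ler_powR; rewrite ?nnegrE ?mulr_ge0//.
by rewrite -ler_pdivrMl// mulr1.
Qed.

(** The dominating sum consists of cut-off integrals in the coordinate directions, finitely many
    finite terms. *)
Lemma angular_integrable : (\int[mu]_(om in S) (angular om)%:E < +oo)%E.
Proof.
pose F (i : 'I_(d + d)) om :=
  (`|dotv (delta_mx ord0 i) om| `^ theta * angular om)%:E.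
have mF i : measurable_fun S (F i).
  apply: measurable_funTS; apply/measurable_EFinP; exact: measurable_angular_kernel.
have F0 i om : S om -> (0 <= F i om)%E.
  by move=> hom; rewrite lee_fin mulr_ge0 ?powR_ge0 ?angular_ge0.
have mS := measurable_usphere.
apply: (@le_lt_trans _ _ (\int[mu]_(om in S)
    (((d + d)%:R `^ theta)%:E * \sum_(i < d + d) F i om))%E).
  apply: ge0_le_integral_lower => om hom; first by rewrite lee_fin angular_ge0.
  by rewrite sumEFin -EFinM lee_fin angular_le_sum.
rewrite ge0_integralZl_EFin ?powR_ge0//; last first.
- exact: emeasurable_sum.
- by move=> om hom; apply: sume_ge0 => i _; exact: F0.
rewrite lte_mul_pinfty ?lee_fin ?powR_ge0// ge0_integral_sum//.
apply: lte_sum_pinfty => i _; rewrite -b3_normE; last exact: delta_usphere.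
exact/cutoff/delta_usphere.
Qed.

Lemma angular_uniformly_integrable (eps : R) : 0 < eps ->
  exists2 eta : R, 0 < eta & forall B, measurable B -> (mu B <= eta%:E)%E ->
  (\int[mu]_(om in S) (angular om * \1_B om)%:E <= eps%:E)%E.
Proof.
move=> eps0; have mS := measurable_usphere.
have intf : mu.-integrable setT (EFin \o (angular \_ S)).
  apply/integrableP; split.
    apply/measurable_EFinP/(measurable_restrictT _ _).1 => //.
    by apply: measurable_funTS; exact: measurable_angular.
  rewrite (_ : \int[mu]_x _ = \int[mu]_(om in S) (angular om)%:E)%E.
    exact: angular_integrable.
  rewrite [RHS]integral_mkcond; apply: eq_integral => om _ /=.
  rewrite !patchE; case: ifPn => [/set_mem hom|_]; last by rewrite normr0.
  by rewrite ger0_norm ?angular_ge0.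
have [eta [eta0 H]] := integral_normr_continuous intf eps0.
(* Halving turns the strict bound on the measure, needed for absolute continuity, into a weak
   one. *)
exists (eta / 2); first by rewrite divr_gt0.
move=> B mB hB; have /(H B mB) : (mu B < eta%:E)%E.
  by apply: le_lt_trans hB _; rewrite lte_fin; lra.
rewrite /Rintegral -lte_fin fineK; last first.
  rewrite ge0_fin_numE; last by apply: integral_ge0 => x _; rewrite lee_fin normr_ge0.
  move/integrableP : intf => [mf]; apply: le_lt_trans.
  apply: ge0_subset_integral => //=.
  apply/measurable_EFinP; apply: measurableT_comp => //; exact/measurable_EFinP.
move=> /ltW; apply: le_trans; rewrite [leLHS]integral_mkcond [leRHS]integral_mkcond.
apply: ge0_le_integral_lower => om _; rewrite !patchE.
  case: ifPn => // /set_mem hom.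
  by rewrite lee_fin mulr_ge0 ?angular_ge0// indicE.
rewrite indicE; case: (boolP (om \in S)) => hS; case: (boolP (om \in B)) => hB' //=.
- by rewrite mulr1 lee_fin ler_norm.
- by rewrite mulr0.
- by rewrite lee_fin normr_ge0.
Qed.

End angular_kernel.

(** * The bound on the gain integral *)

Section gain_bound.
Context {R : realType} {d : nat}.
Variables (b3 : R -> R -> R) (theta : R) (phi : R -> R).
Hypothesis d0 : (0 < d)%N.
Hypothesis theta0 : 0 <= theta.
Hypothesis mphi : measurable_fun setT (phi \_ `[- (1 / 2), 1 / 2]).
Hypothesis b3E : forall x y : R, -1 <= x <= 1 -> - (1 / 2) <= y <= 1 / 2 ->
  b3 x y = `|x| `^ theta * phi y.
Hypothesis b3_ge0 : forall x y : R, -1 <= x <= 1 -> - (1 / 2) <= y <= 1 / 2 ->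
  0 <= b3 x y.
Hypothesis cutoff : forall e : 'rV[R]_(d + d), usphere R (d + d) e ->
  (b3_norm b3 e < +oo)%E.

Local Notation S := (usphere R (d + d)).
Local Notation mu := (@sphere_measure R (d + d)).

Lemma powR_le_mul (p M s : R) : 1 <= p -> 0 < s <= M ->
  s `^ p <= M `^ (p - 1) * s.
Proof.
move=> p1 /andP[s0 sM].
have -> : s `^ p = s `^ (p - 1) * s.
  by rewrite -{3}(powRr1 (ltW s0)) -powRD ?subrK// (gt_eqF s0) implybT.
rewrite ler_wpM2r ?(ltW s0)//; apply: ge0_ler_powR => //.
- by rewrite subr_ge0.
- by rewrite nnegrE ltW.
- by rewrite nnegrE (le_trans (ltW s0)).
Qed.

Lemma japanese_powR (x : 'rV[R]_d) p :
  japanese x `^ (2 * p) = (japanese x ^+ 2) `^ p.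
Proof. by rewrite powRrM powR_mulrn// sqrtr_ge0. Qed.

Lemma japanese_sqr_ge1 (x : 'rV[R]_d) : 1 <= japanese x ^+ 2.
Proof. by rewrite japanese_sqr lerDl dotvv_ge0. Qed.

Lemma japanese_powR_le (x y z : 'rV[R]_d) p M : 1 <= p ->
  japanese x ^+ 2 <= M -> japanese y ^+ 2 <= M -> japanese z ^+ 2 <= M ->
  japanese x `^ (2 * p) + japanese y `^ (2 * p) + japanese z `^ (2 * p) <=
  M `^ (p - 1) * ternary_energy x y z.
Proof.
move=> p1 xM yM zM; rewrite !japanese_powR /ternary_energy !mulrDr.
by rewrite !lerD// powR_le_mul// (lt_le_trans ltr01 (japanese_sqr_ge1 _)).
Qed.

(** Since [tilde_norm] dominates [|u|], [ubar] is a shrunken copy of the unit direction. With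
    [theta >= 0] the kernel at [ubar] is therefore at most the kernel at that direction, whose
    integral is the cut-off norm. *)
Lemma dotv_ubar (v v1 v2 : 'rV[R]_d) om : rel_velocity v v1 v2 != 0 ->
  let u := rel_velocity v v1 v2 in
  dotv (ubar v v1 v2) (ubar v v1 v2) <= 1 /\
  `|dotv (ubar v v1 v2) om| <= `|dotv ((enorm u)^-1 *: u) om|.
Proof.
move=> u0 /=; set u := rel_velocity _ _ _ in u0 *.
have U0 : 0 < enorm u by rewrite sqrtr_gt0 dotvv_gt0.
have uT : enorm u <= tilde_norm v v1 v2.
  rewrite ler_wsqrtr// /u dotv_row_mx !enorm_sqr.
  have := dotvv_ge0 (v1 - v2).
  by rewrite !dotvE (dotvC v1 v) (dotvC v2 v) (dotvC v2 v1); lra.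
have T0 := lt_le_trans U0 uT.
rewrite /ubar -/u !dotvZl dotvZr -enorm_sqr; split.
  rewrite mulrA -expr2 -exprMn.
  apply: exprn_ile1; first by rewrite mulr_ge0 ?invr_ge0// ltW.
  by rewrite ler_pdivrMl// mulr1.
by rewrite !normrM ler_wpM2r// !normfV !gtr0_norm// lef_pV2.
Qed.

Lemma kernel_mul_le (x y P s W : R) : 0 <= x <= y -> 0 <= P -> 0 <= s <= W ->
  x * P * s <= W * (y * P).
Proof.
move=> /andP[x0 xy] P0 /andP[s0 sW]; rewrite [leRHS]mulrC.
by rewrite ler_pM// ?mulr_ge0// ler_wpM2r.
Qed.

(** For exceptional directions: [W] splits as [rho * W + (1 - rho) * W]. The first part has the form
    of the bound for ordinary directions; in the second the weight [y] is dropped, leaving only the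
    angular factor. *)
Lemma kernel_mul_le_split (x y P s W rho : R) : 0 <= x <= y -> y <= 1 ->
  0 <= P -> 0 <= s <= W -> rho <= 1 ->
  x * P * s <= rho * W * (y * P) + (1 - rho) * W * P.
Proof.
move=> xy y1 P0 sW rho1; apply: le_trans (kernel_mul_le xy P0 sW) _.
rewrite -subr_ge0; have -> : rho * W * (y * P) + (1 - rho) * W * P - W * (y * P) =
  (1 - rho) * W * (P * (1 - y)) by ring.
by move: sW => /andP[s0 sW]; rewrite !mulr_ge0// ?subr_ge0// (le_trans s0).
Qed.

(* Where no outgoing particle carries more than [rho0 * E], convexity of the
   power function gains the factor [rho]; the remaining directions have small
   mass. *)
Lemma gain_bound (eps : R) : 0 < eps ->
  exists2 rho0 : R, 0 < rho0 < 1 &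
  forall p (v v1 v2 : 'rV[R]_d), 1 <= p -> rel_velocity v v1 v2 != 0 ->
  let u := rel_velocity v v1 v2 in
  (ternary_gain b3 (2 * p) v v1 v2 <=
   ((rho0 `^ (p - 1) * fine (b3_norm b3 ((enorm u)^-1 *: u)) +
     (1 - rho0 `^ (p - 1)) * eps) * ternary_energy v v1 v2 `^ p)%:E)%E.
Proof.
move=> eps0.
have [eta eta0 hpsi] :=
  angular_uniformly_integrable d0 theta0 mphi b3E b3_ge0 cutoff eps0.
have [del /andP[del0 del1] hB] := @exists_exceptional_set R d eta d0 eta0.
exists (1 - del); first by apply/andP; split; lra.
move=> p v v1 v2 p1 u0 /=; set u := rel_velocity v v1 v2.
have [B [mB Beta nB]] := hB _ _ _ u0.
set rho := (1 - del) `^ (p - 1); set E := ternary_energy v v1 v2.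
set e := (enorm u)^-1 *: u; have he : S e := normalize_usphere u0.
have E0 : 0 < E.
  rewrite /E ternary_energyE; have := dotvv_ge0 v; have := dotvv_ge0 v1.
  by have := dotvv_ge0 v2; lra.
have rho1 : 0 <= rho <= 1.
  rewrite powR_ge0/=.
  have -> : 1 = 1 `^ (p - 1) :> R by rewrite powR1.
  by apply: ge0_ler_powR; rewrite ?nnegrE; lra.
have EE : E `^ (p - 1) * E = E `^ p.
  rewrite -{2}(powRr1 (ltW E0)) -powRD ?subrK//.
  by rewrite (gt_eqF E0) implybT.
pose psi := @angular R d phi.
have psi0 om : S om -> 0 <= psi om by exact: (angular_ge0 b3E b3_ge0).
pose f om := (`|dotv e om| `^ theta * psi om)%:E.
pose g om := (psi om * \1_B om)%:E.
have mS := @measurable_usphere R d.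
have mf : measurable_fun S f.
  apply: measurable_funTS; apply/measurable_EFinP.
  exact: (measurable_angular_kernel theta mphi e).
have mg : measurable_fun S g.
  apply: measurable_funTS; apply/measurable_EFinP; apply: measurable_funM.
    exact: (measurable_angular mphi).
  exact: measurable_indic.
have f0 om : S om -> (0 <= f om)%E.
  by move=> hom; rewrite lee_fin mulr_ge0 ?powR_ge0 ?psi0.
have g0 om : S om -> (0 <= g om)%E.
  by move=> hom; rewrite lee_fin mulr_ge0 ?psi0// indicE.
have a0 : 0 <= rho * E `^ p by rewrite mulr_ge0 ?powR_ge0.
have b0 : 0 <= (1 - rho) * E `^ p.
  by rewrite mulr_ge0 ?powR_ge0// subr_ge0; case/andP: rho1.
(* The dominating integrand is [rho * E^p] times the kernel in direction [e] everywhere, plus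
   [(1 - rho) * E^p] times [psi] on [B] alone. *)
apply: (@le_trans _ _ (\int[mu]_(om in S)
    ((rho * E `^ p)%:E * f om + ((1 - rho) * E `^ p)%:E * g om))%E).
  apply: ge0_le_integral_lower => om hom.
    have [a1 _] := dotv_ubar om u0.
    rewrite lee_fin mulr_ge0 ?addr_ge0 ?powR_ge0//.
    by apply: b3_ge0; [exact: dotv_bound|exact: dotv_hsubmx_bound].
  have [a1 a2] := dotv_ubar om u0.
  rewrite lee_fin (b3_angular b3E)// -/psi.
  have P0 := psi0 _ hom.
  set s := (X in _ * X <= _); set x := `|_| `^ theta.
  set y := `|dotv e om| `^ theta.
  have xy : 0 <= x <= y.
    by rewrite powR_ge0; apply: ge0_ler_powR; rewrite ?nnegrE.
  have y1 : y <= 1.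
    rewrite /y; have -> : 1 = 1 `^ theta :> R by rewrite powR1.
    apply: ge0_ler_powR; rewrite ?nnegrE// ler_norml.
    by apply: dotv_bound => //; rewrite (usphereE e).1.
  have s0 : 0 <= s by rewrite !addr_ge0 ?powR_ge0.
  have SE := star_energy v v1 v2 hom.
  have le_energy (a b c : 'rV[R]_d) : ternary_energy a b c = E ->
      [/\ japanese a ^+ 2 <= E, japanese b ^+ 2 <= E & japanese c ^+ 2 <= E].
    rewrite /ternary_energy; have := japanese_sqr_ge1 a.
    have := japanese_sqr_ge1 b; have := japanese_sqr_ge1 c.
    by move=> *; split; lra.
  rewrite indicE; case: (boolP (om \in B)) => [_|/negP omB] /=.
    have sE : s <= E `^ p.
      have [h0 h1 h2] := le_energy _ _ _ SE.
      apply: le_trans (japanese_powR_le p1 h0 h1 h2) _.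
      by rewrite SE EE.
    rewrite mulr1; apply: (kernel_mul_le_split xy y1 P0); last by case/andP: rho1.
    exact: (introT andP (conj s0 sE)).
  rewrite !mulr0 addr0.
  have [|h0 h1 h2] := nB om hom; first by move=> h; apply: omB; rewrite inE.
  have sE : s <= rho * E `^ p.
    apply: le_trans (japanese_powR_le p1 h0 h1 h2) _.
    by rewrite SE powRM ?(ltW E0) -?mulrA ?EE//; lra.
  exact: (kernel_mul_le xy P0 (introT andP (conj s0 sE))).
rewrite ge0_integralD//; last 4 first.
- by move=> om hom; rewrite mule_ge0// f0.
- by apply: emeasurable_funM => //; exact: measurable_cst.
- by move=> om hom; rewrite mule_ge0// g0.
- by apply: emeasurable_funM => //; exact: measurable_cst.
rewrite !ge0_integralZl_EFin// -/(b3_norm b3 e).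
have -> : (\int[mu]_(om in S) f om = (fine (b3_norm b3 e))%:E)%E.
  rewrite fineK -?(b3_normE b3E)// ge0_fin_numE ?cutoff//.
  rewrite (b3_normE b3E)//; exact: integral_ge0.
apply: (@le_trans _ _ ((rho * E `^ p)%:E * (fine (b3_norm b3 e))%:E +
   ((1 - rho) * E `^ p)%:E * eps%:E)%E).
  by apply: leeD => //; apply: lee_wpmul2l => //; exact: hpsi.
by rewrite -!EFinM -EFinD lee_fin [leRHS]mulrDl !(mulrAC _ (E `^ p)).
Qed.

End gain_bound.

(** * Decay of powers and construction of the coercive map *)

Lemma powR_decay (R : realType) (r y : R) : 0 < r < 1 -> 0 < y ->
  r `^ y <= (y * - ln r)^-1.
Proof.
move=> /andP[r0 r1] y0; have l0 : 0 < - ln r by rewrite oppr_gt0 ln_lt0// r0.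
have c0 : 0 < y * - ln r by rewrite mulr_gt0.
rewrite /powR gt_eqF// -[y * ln r]opprK expRN lef_pV2 ?posrE ?expR_gt0// -mulrN.
by apply: le_trans (expR_ge1Dx _); rewrite lerDr.
Qed.

Lemma ltr_powR_anti (R : realType) (r x y : R) : 0 < r < 1 -> x < y ->
  r `^ y < r `^ x.
Proof.
move=> hr xy; have /andP[r0 _] := hr.
by rewrite /powR gt_eqF// ltr_expR ltr_nM2r// ln_lt0.
Qed.

(* [Lam p] is the best constant valid for all exponents [q >= p]; it need not
   be strictly decreasing, nor equal to [N] at [1], so it is averaged with
   [N] with weight [1 / p]. *)
Lemma coercive_map (R : realType) (I : Type) (G : R -> I -> \bar R)
    (E : I -> R) (N : R) : 0 < N -> (forall i, 0 < E i) ->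
  (forall eps, 0 < eps -> exists2 rho0 : R, 0 < rho0 < 1 &
    forall q i, 1 <= q -> (G q i <=
      ((rho0 `^ (q - 1) * N + (1 - rho0 `^ (q - 1)) * eps) * E i `^ q)%:E)%E) ->
  exists lambda : R -> R,
    [/\ forall p q : R, 1 <= p -> p < q -> lambda q < lambda p,
        lambda 1 = N,
        lambda x @[x --> +oo] --> (0 : R) &
        forall q i, 1 <= q -> (G q i <= (lambda q * E i `^ q)%:E)%E].
Proof.
move=> N0 E0 HG.
pose T (p : R) : set R := [set L | 0 <= L /\
  forall q i, p <= q -> (G q i <= (L * E i `^ q)%:E)%E].
have T_lb p : has_lbound (T p) by exists 0 => L [].
have T_bound (eps : R) : 0 < eps <= N -> exists2 rho0 : R, 0 < rho0 < 1 &
    forall p, 1 <= p ->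
    T p (rho0 `^ (p - 1) * N + (1 - rho0 `^ (p - 1)) * eps).
  move=> /andP[e0 eN]; have [rho0 hr H] := HG eps e0.
  have /andP[r0 r1] := hr; exists rho0 => // p p1.
  have anti (x y : R) : x <= y -> rho0 `^ y <= rho0 `^ x.
    by move=> xy; apply: ger_powR => //; rewrite r0 ltW.
  split.
    rewrite addr_ge0 ?mulr_ge0 ?powR_ge0 ?(ltW N0) ?(ltW e0)// subr_ge0.
    by rewrite -[leRHS](powRr0 rho0) anti// subr_ge0.
  move=> q i pq; apply: le_trans (H q i (le_trans p1 pq)) _.
  rewrite lee_fin ler_wpM2r ?powR_ge0//.
  have h : rho0 `^ (q - 1) <= rho0 `^ (p - 1) by rewrite anti// lerD2r.
  (* The bound is affine in the power of [rho0] with slope [N - eps >= 0], so it decreases in the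
     exponent and its value at [p] serves all [q >= p]. *)
  have -> : forall x : R, x * N + (1 - x) * eps = x * (N - eps) + eps by move=> x; ring.
  have -> : forall x : R, x * N + (1 - x) * eps = x * (N - eps) + eps by move=> x; ring.
  by rewrite lerD2r ler_wpM2r// subr_ge0.
have TN p : 1 <= p -> T p N.
  (* With [eps = N] the convex combination equals [N] for every [rho0]; with [eps = N / 2], used
     below, it is strictly smaller when [p > 1]. *)
  move=> p1; have [|rho0 _ /(_ p p1)] := T_bound N; first by rewrite N0 lexx.
  by congr (T p _); ring.
pose Lam p := inf (T p).
have Lam_ge0 p : 1 <= p -> 0 <= Lam p.
  by move=> p1; apply: lb_le_inf; [exists N; exact: TN|move=> L []].
have Lam_le p L : T p L -> Lam p <= L by move=> TL; exact: ge_inf.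
have Lam_decr p q : 1 <= p -> p <= q -> Lam q <= Lam p.
  move=> p1 pq; apply: lb_le_inf; first by exists N; exact: TN.
  move=> L [L0 HL]; apply: Lam_le; split=> // s i qs.
  by apply: HL; exact: le_trans qs.
have Lam_lt p : 1 < p -> Lam p < N.
  move=> p1; have [|rho0 hr /(_ p (ltW p1)) /Lam_le] := T_bound (N / 2).
    by apply/andP; split; lra.
  move/le_lt_trans; apply; set x := rho0 `^ _.
  have x1 : x < 1 by rewrite -[ltRHS](powRr0 rho0) ltr_powR_anti// subr_gt0.
  have : 0 < (1 - x) * (N / 2) by rewrite mulr_gt0 ?subr_gt0// divr_gt0.
  lra.
have Lam_bound q i : 1 <= q -> (G q i <= (Lam q * E i `^ q)%:E)%E.
  move=> q1; have := (TN q q1).2 q i (lexx q).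
  (* The bound with [N] excludes [+oo]. A finite value divided by [E^q] is a lower bound of [T q],
     so the infimum is itself admissible. *)
  case Gq : (G q i) => [g| |]; [|by rewrite leye_eq => /eqP|by move=> _; rewrite leNye].
  move=> _; have Eq : 0 < E i `^ q by rewrite powR_gt0.
  rewrite lee_fin -ler_pdivrMr//; apply: lb_le_inf; first by exists N; exact: TN.
  move=> L [L0 /(_ q i (lexx q))]; rewrite Gq lee_fin.
  by rewrite ler_pdivrMr.
have Lam_leN p : 1 <= p -> Lam p <= N by move=> p1; apply: Lam_le; exact: TN.
exists (fun p => N / p + (1 - p^-1) * Lam p); split.
- move=> p q p1 pq.
  have p0 : 0 < p by exact: lt_le_trans ltr01 p1.
  have q1 : 1 < q by exact: le_lt_trans pq.
  have ip : p^-1 <= 1 by rewrite invf_le1.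
  have iqp : q^-1 < p^-1 by rewrite ltf_pV2// posrE (lt_trans p0).
  (* The difference of the two values is [(1 - 1/p) (Lam p - Lam q) + (1/p - 1/q) (N - Lam q)]; the
     second term is positive even at [p = 1], because [q > 1]. *)
  have h1 : (1 - p^-1) * Lam q <= (1 - p^-1) * Lam p.
    by rewrite ler_wpM2l ?subr_ge0// Lam_decr// ltW.
  have h2 : 0 < (N - Lam q) * (p^-1 - q^-1) by rewrite mulr_gt0 ?subr_gt0// Lam_lt.
  lra.
- by rewrite invr1 subrr mul0r addr0 mulr1.
(* Three contributions of at most [e / 3] each: [N / p], the decaying power times [N], and the [eps]
   term. *)
- apply/cvgrPdist_le => e e0; pose eps := Num.min N (e / 3).
  have eps0 : 0 < eps by rewrite lt_min N0 divr_gt0.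
  have [|rho0 hr HT] := T_bound eps; first by rewrite eps0 ge_min lexx.
  pose c := - ln rho0.
  have c0 : 0 < c by case/andP: hr => r0 r1; rewrite oppr_gt0 ln_lt0// r0.
  near=> p.
  have p1 : 1 < p by near: p; apply: nbhs_pinfty_gt; exact: num_real.
  have p0 : 0 < p by exact: lt_trans p1.
  have pN : 3 * N / e <= p by near: p; apply: nbhs_pinfty_ge; exact: num_real.
  have pc : 3 * N / (e * c) + 1 <= p by near: p; apply: nbhs_pinfty_ge; exact: num_real.
  have ip : p^-1 <= 1 by rewrite invf_le1// ltW.
  have ip0 : 0 < p^-1 by rewrite invr_gt0.
  have L0 := Lam_ge0 p (ltW p1).
  rewrite sub0r normrN ger0_norm; last first.
    by rewrite addr_ge0// ?mulr_ge0// ?subr_ge0// ltW.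
  have h1 : N / p <= e / 3.
    by rewrite ler_pdivrMr//; move: pN; rewrite ler_pdivrMr//; lra.
  have h2 : (1 - p^-1) * Lam p <= Lam p by rewrite ler_piMl// gerBl ltW.
  have h3 := Lam_le _ _ (HT p (ltW p1)).
  have h4 : rho0 `^ (p - 1) * N <= e / 3.
    have y0 : 0 < p - 1 by rewrite subr_gt0.
    have yc : 0 < (p - 1) * c by rewrite mulr_gt0.
    have d := powR_decay hr y0.
    apply: (@le_trans _ _ (((p - 1) * c)^-1 * N)); first by rewrite ler_wpM2r// ltW.
    rewrite ler_pdivrMl//; move: pc; rewrite -lerBrDr ler_pdivrMr ?mulr_gt0//.
    lra.
  have h5 : (1 - rho0 `^ (p - 1)) * eps <= e / 3.
    apply: (@le_trans _ _ eps); last by rewrite ge_min lexx orbT.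
    by rewrite ler_piMl ?gerBl ?powR_ge0// ltW.
  lra.
- move=> q i q1; apply: le_trans (Lam_bound q i q1) _.
  rewrite lee_fin ler_wpM2r ?powR_ge0//.
  (* The averaged value exceeds [Lam q] by [(N - Lam q) / q >= 0]. *)
  have iq : 0 <= q^-1 by rewrite invr_ge0 (le_trans ler01).
  have : 0 <= q^-1 * (N - Lam q) by rewrite mulr_ge0// subr_ge0 Lam_leN.
  lra.
Unshelve. all: end_near.
Qed.

(** * The ternary coercive map for the collision kernel *)

Theorem lemma3p3 (R : realType) (d : nat) (hd : (0 < d)%N)
  (b3 : R -> R -> R) (theta3 : R) (phi : R -> R)
  (htheta3 : 0 <= theta3)
  (hphi : (phi \_ (`[- (1 / 2), 1 / 2] : set R)) \in Lfun lebesgue_measure +oo%E)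
  (hb3 : forall x y : R, -1 <= x <= 1 -> - (1 / 2) <= y <= 1 / 2 ->
    b3 x y = `|x| `^ theta3 * phi y)
  (hb3_ge0 : forall x y : R, -1 <= x <= 1 -> - (1 / 2) <= y <= 1 / 2 ->
    0 <= b3 x y)
  (hcutoff : forall e : 'rV[R]_(d + d), usphere R (d + d) e ->
    (b3_norm b3 e < +oo)%E)
  (hdirection : forall e e' : 'rV[R]_(d + d),
    usphere R (d + d) e -> usphere R (d + d) e' -> b3_norm b3 e = b3_norm b3 e')
  (hnonzero : forall e : 'rV[R]_(d + d), usphere R (d + d) e ->
    (0 < b3_norm b3 e)%E) :
  exists lambda : R -> R,
    [/\ (forall p q : R, 1 <= p -> p < q -> lambda q < lambda p),
        (forall e : 'rV[R]_(d + d), usphere R (d + d) e ->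
           (lambda 1)%:E = b3_norm b3 e),
        lambda x @[x --> +oo] --> (0 : R) &
        forall (k : R) (v v1 v2 : 'rV[R]_d), 2 <= k ->
          rel_velocity v v1 v2 != 0 ->
          (ternary_gain b3 k v v1 v2 <=
             (lambda (k / 2) * ternary_energy v v1 v2 `^ (k / 2))%:E)%E].
Proof.
have mphi : measurable_fun setT (phi \_ `[- (1 / 2), 1 / 2]).
  by move: hphi => /sub_Lfun_mfun; rewrite inE.
have dd0 : (0 < d + d)%N by rewrite addn_gt0 hd.
pose e0 : 'rV[R]_(d + d) := delta_mx ord0 (Ordinal dd0).
have he0 : usphere R (d + d) e0 := delta_usphere _.
pose N := fine (b3_norm b3 e0).
have NE e : usphere R (d + d) e -> b3_norm b3 e = N%:E.
  move=> he; rewrite (hdirection _ _ he he0) fineK// ge0_fin_numE ?hcutoff//.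
  exact/ltW/hnonzero.
have N0 : 0 < N by rewrite -lte_fin -(NE _ he0) hnonzero.
(* The index packs a velocity triple with its nonzero relative velocity, so that a single [lambda]
   serves all of them. *)
pose I := {x : 'rV[R]_d * 'rV[R]_d * 'rV[R]_d |
  rel_velocity x.1.1 x.1.2 x.2 != 0}.
have [|eps eps0|lambda [ldec l1 lcvg lE]] := @coercive_map R I
  (fun q i => ternary_gain b3 (2 * q) (val i).1.1 (val i).1.2 (val i).2)
  (fun i => ternary_energy (val i).1.1 (val i).1.2 (val i).2) N N0.
- move=> i; rewrite ternary_energyE ltr_wpDr ?ltr0n//.
  by rewrite !addr_ge0 ?dotvv_ge0.
- have [rho0 hrho H] := gain_bound hd htheta3 mphi hb3 hb3_ge0 hcutoff eps0.
  exists rho0 => // q [x hx] q1 /=; have := H q _ _ _ q1 hx.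
  by rewrite /= NE//; exact: normalize_usphere.
- exists lambda; split=> //.
    by move=> e he; rewrite NE// l1.
  move=> k v v1 v2 k2 hu.
  have k1 : 1 <= k / 2 by rewrite ler_pdivlMr ?mul1r.
  have := lE (k / 2) (exist _ (v, v1, v2) hu) k1.
  by rewrite /= mulrC divfK.
Qed.
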